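(* Let $a_{i,j,k,l}$, $1\le i,j,k,l\le n$, be a collection of real numbers such that $a_{i,j,k,l}=0$ if $i=j$ or $k=l$, $\sum_{i,j,k,l}a_{i,j,k,l}=0$, and $a_{i,j,k,l}=a_{i,j,l,k}=a_{j,i,l,k}$ for all $i,j,k,l$. Let $\pi$ be a permutation chosen uniformly at random from the symmetric group $S_n$ and let $$V_1=\sum_{1\le s\ne t\le n}a_{s,t,\pi(s),\pi(t)}.$$ If $\sup_{i,j,k,l}|a_{i,j,k,l}|\le b$, then $W_1=n^{-3/2}V_1$ satisfies, for all $t>0$, $$P(W_1\ge t)\le\exp\left(-\frac{t^2}{2\phi_{b,n}}\right)\quad\text{and}\quad P(W_1\le -t)\le\exp\left(-\frac{t^2}{2\phi_{b,n}}\right),$$ where $$\phi_{b,n}=\frac{8(2n-1)b^2(6+4/n+1/n^2)}{n}.$$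
   Context: The sum $\sum_{1\le s\ne t\le n}$ runs over all ordered pairs $(s,t)$ with $s\neq t$ and $s,t\in\{1,\dots,n\}$. *)

(* Defs.v *)
From HB Require Import structures.
From mathcomp Require Import all_boot all_order all_algebra all_fingroup.
From mathcomp Require Import all_classical all_reals all_analysis.

Set Implicit Arguments.
Unset Strict Implicit.
Unset Printing Implicit Defensive.

Import Order.TTheory GRing.Theory Num.Theory.

Local Open Scope ring_scope.

Definition unif_perm_prob (R : realType) (n : nat) (E : pred 'S_n) : R :=
  #|E|%:R / #|'S_n|%:R.

Definition V1 (R : realType) (n : nat) (a : 'I_n -> 'I_n -> 'I_n -> 'I_n -> R)
    (p : 'S_n) : R :=
  \sum_(s < n) \sum_(t < n | s != t) a s t (p s) (p t).

Definition W1 (R : realType) (n : nat) (a : 'I_n -> 'I_n -> 'I_n -> 'I_n -> R)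
    (p : 'S_n) : R :=
  n%:R `^ (- (3 / 2)) * V1 a p.

Definition phi (R : realType) (b : R) (n : nat) : R :=
  8 * (2 * n%:R - 1) * b ^+ 2 * (6 + 4 / n%:R + 1 / n%:R ^+ 2) / n%:R.

(* For b = 0 the variance proxy phi b n vanishes; the extended-real quotient
   reads t ^+ 2 / 0 as +oo, so that the bound is then exp(-oo) = 0, whereas the
   junk value t ^+ 2 / 0 = 0 of the field R would give the trivial bound 1. *)
Definition gauss_tail (R : realType) (t v : R) : \bar R :=
  expeR (- ((t ^+ 2)%:E / (2 * v)%:E))%E.

(* Main.v *)
Require Import Defs.
From HB Require Import structures.
From mathcomp Require Import all_boot all_order all_algebra all_fingroup.
From mathcomp Require Import all_classical all_reals all_analysis.
From mathcomp Require Import ring lra.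

Import numFieldNormedType.Exports.

Import Order.TTheory GRing.Theory Num.Theory.

Local Open Scope ring_scope.

(* Composing [p] with a transposition changes at most [4 n] of the terms of
   [V1 a p], each by at most [2 b], so [V1] has differences bounded by [8 n b]
   along transpositions. A function on ['S_n] of mean zero with differences
   bounded by [c] has moment generating function at most
   [exp (n l^2 c^2 / 2)], by revealing the values of the permutation one at a
   time. For [W1] this gives [n c^2 = 64 b^2 <= phi b n], and Chernoff's bound
   concludes. *)

(** * Exponential moments on a finite set *)

Lemma leq_expn2_fact_double (k : nat) : (2 ^ k * k`! <= (k.*2)`!)%N.
Proof.
elim: k => // k IH; rewrite doubleS !factS expnS.
rewrite [leqLHS](_ : _ = (k.+1.*2 * (2 ^ k * k`!))%N); last first.
  by rewrite -muln2; ring.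
by rewrite doubleS leq_mul// (leq_trans IH)// leq_pmull.
Qed.

(* Termwise comparison of the even part of the exponential series. *)
Lemma expR_symm_le (R : realType) (x : R) :
  expR x + expR (- x) <= 2 * expR (x ^+ 2 / 2).
Proof.
have cv y := is_cvg_series_exp_coeff (y : R).
(* In each new pair of terms the odd ones cancel; the even ones compare because [2 ^ k * k!] is at
   most [(2k)!]. *)
have partial n : series (exp_coeff x) n.*2 + series (exp_coeff (- x)) n.*2
    <= 2 * series (exp_coeff (x ^+ 2 / 2)) n.
  rewrite /series/= !big_mkord; elim: n => [|n IH].
    by rewrite !big_ord0 mulr0 addr0.
  rewrite doubleS !big_ord_recr/= mulrDr.
  have even : (- x) ^+ n.*2 = x ^+ n.*2 by rewrite -mul2n !exprM sqrrN.
  rewrite /exp_coeff/= [(- x) ^+ n.*2.+1]exprS even mulNr -exprS.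
  set A := \sum_(i < _) _ in IH *; set B := \sum_(i < _) _ in IH *.
  set C := \sum_(i < _) _ in IH *.
  set y := x ^+ n.*2.+1 / _.
  have -> : - x ^+ n.*2.+1 / (n.*2.+1)`!%:R = - y by rewrite mulNr.
  suff : x ^+ n.*2 / (n.*2)`!%:R <= (x ^+ 2 / 2) ^+ n / n`!%:R by lra.
  rewrite expr_div_n -exprM mul2n -mulrA -invfM.
  rewrite ler_wpM2l//; first by rewrite -mul2n exprM exprn_ge0// sqr_ge0.
  rewrite lef_pV2 ?posrE ?mulr_gt0 ?exprn_gt0 ?ltr0n ?fact_gt0//.
  by rewrite -natrX -natrM ler_nat leq_expn2_fact_double.
have dbl (u : nat -> R) (l : R) : (u @ \oo --> l -> u n.*2 @[n --> \oo] --> l)%classic.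
  move=> ul; apply: (cvg_comp (fun n : nat => n.*2) u _ ul).
  apply/cvgnyPge => N; near=> n; rewrite -addnn (leq_trans _ (leq_addr _ _))//.
  by near: n; exact: nbhs_infty_ge.
apply: (@ler_cvg_to _ \oo%classic _ _
   (fun n => series (exp_coeff x) n.*2 + series (exp_coeff (- x)) n.*2)
   (fun n => 2 * series (exp_coeff (x ^+ 2 / 2)) n)).
- by apply: cvgD; apply: dbl; exact: cv.
- by apply: cvgMl_tmp; exact: cv.
- by near=> n; exact: partial.
Unshelve. all: by end_near. Qed.

(* Symmetrisation: multiply by [\sum_j expR (- m j)], which by Jensen is at
   least [#|I| * expR (- mean)]. *)
Lemma sum_expR_le (R : realType) (I : finType) (m : I -> R) (c : R) :
  (forall i j, `|m i - m j| <= c) ->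
  \sum_i expR (m i) <=
    #|I|%:R * expR ((\sum_i m i) / #|I|%:R + c ^+ 2 / 2).
Proof.
move=> mc; set N : R := #|I|%:R; set mu := _ / N.
have [I0|I_gt0] := posnP #|I|.
  by rewrite /N I0 mul0r big_pred0// => i; apply/negbTE; have := fintype0 i I0.
have N_gt0 : 0 < N by rewrite ltr0n.
set S := \sum_i expR (m i); pose S' := \sum_i expR (- m i).
have S'_ge : N * expR (- mu) <= S'.
  (* Tangent line of the exponential at the mean: the linear terms [mu - m i] sum to zero. *)
  have -> : N * expR (- mu) = \sum_i (1 + (mu - m i)) * expR (- mu).
    rewrite -mulr_suml; congr (_ * _).
    rewrite big_split/= sumr_const -/N sumrB sumr_const -[mu *+ _]mulr_natr -/N.
    by rewrite divfK ?gt_eqF// subrr addr0.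
  apply: ler_sum => i _.
  rewrite [leRHS](_ : _ = expR (mu - m i) * expR (- mu)); last first.
    by rewrite -expRD addrAC subrr add0r.
  by rewrite ler_wpM2r ?expR_ge0 ?expR_ge1Dx.
have SS' : S * S' <= N ^+ 2 * expR (c ^+ 2 / 2).
  (* Adding the swapped product pairs each [expR (m i - m j)] with its inverse, the form bounded by
     [expR_symm_le]. *)
  suff : S * S' + S' * S <= 2 * (N ^+ 2 * expR (c ^+ 2 / 2)).
    by rewrite [S' * S]mulrC => ?; lra.
  rewrite /S /S' !big_distrlr/= -big_split/=.
  under eq_bigr do rewrite -big_split/=.
  have -> : 2 * (N ^+ 2 * expR (c ^+ 2 / 2)) =
      \sum_(i : I) \sum_(j : I) 2 * expR (c ^+ 2 / 2).
    by rewrite !sumr_const -/N -[RHS]mulr_natr -[_ *+ _]mulr_natr -/N; ring.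
  apply: ler_sum => i _; apply: ler_sum => j _.
  rewrite -!expRD [- m i + _](_ : _ = - (m i - m j)); last by ring.
  apply: le_trans (expR_symm_le _ _) _.
  rewrite ler_pM2l// ler_expR ler_pM2r// -[(_ - _) ^+ 2]real_normK ?num_real//.
  by rewrite lerXn2r ?nnegrE// (le_trans _ (mc i j)).
have S_ge0 : 0 <= S by apply: sumr_ge0 => i _; exact: expR_ge0.
have := le_trans (ler_wpM2l S_ge0 S'_ge) SS'.
rewrite expRN expr2 mulrCA -[X in _ <= X]mulrA ler_pM2l//.
by rewrite ler_pdivrMr ?expR_gt0// -mulrA -expRD [_ / 2 + _]addrC.
Qed.

(** * Exponential moments on the symmetric group *)

Lemma lift_perm_tperm (n : nat) (j : 'I_n.+1) (x y : 'I_n) :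
  lift_perm j j (tperm x y) = tperm (lift j x) (lift j y).
Proof.
apply/permP=> k; case: (unliftP j k) => [k'|] ->.
  by rewrite lift_perm_lift inj_tperm //; apply: lift_inj.
by rewrite lift_perm_id tpermD // eq_sym neq_lift.
Qed.

(** Splits permutations by the image [j] of the first point; the parametrisation is injective
    between sets of equal cardinality. *)
Lemma sum_lift_perm (V : nmodType) (n : nat) (F : 'S_n.+1 -> V) :
  \sum_p F p = \sum_j \sum_s F (lift_perm ord0 j s).
Proof.
rewrite pair_big/= (reindex (fun js : 'I_n.+1 * 'S_n =>
  lift_perm ord0 js.1 js.2))//.
apply/onW_bij/inj_card_bij; last first.
  by rewrite card_prod !card_Sn card_ord factS.
move=> [j s] [k r]/= eqp.
have jk : j = k by rewrite -(lift_perm_id ord0 j s) eqp lift_perm_id.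
rewrite -{k}jk in eqp *; congr pair; apply/permP => x.
by apply: (@lift_inj _ j); rewrite -!(lift_perm_lift ord0) eqp.
Qed.

Lemma sum_lift_perm_fixed (V : nmodType) (n : nat) (j : 'I_n.+1)
    (F : 'S_n.+1 -> V) :
  \sum_s F (lift_perm ord0 j s) = \sum_(p : 'S_n.+1 | p ord0 == j) F p.
Proof.
rewrite [RHS]big_mkcond sum_lift_perm (bigD1 j)//= [X in _ + X]big1 ?addr0.
  by apply: eq_bigr => s _; rewrite lift_perm_id eqxx.
by move=> k kj; apply: big1 => s _; rewrite lift_perm_id (negbTE kj).
Qed.

Lemma sum_expR_perm_le (R : realType) (n : nat) (f : 'S_n -> R) (c : R) :
  (forall p i j, `|f p - f (p * tperm i j)%g| <= c) ->
  \sum_p expR (f p) <=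
    n`!%:R * expR ((\sum_p f p) / n`!%:R + n%:R * (c ^+ 2 / 2)).
Proof.
elim: n f => [|n IH] f fc.
  have S01 (F : 'S_0 -> R) : \sum_p F p = F 1%g.
    by rewrite (bigD1 1%g)//= big1 ?addr0// => p; rewrite (permS0 p) eqxx.
  by rewrite !S01 fact0 divr1 mul0r addr0 mul1r.
pose N : R := n`!%:R.
have N_gt0 : 0 < N by rewrite ltr0n fact_gt0.
(* The conditional mean of [f] given [p ord0 = j]. *)
pose m j := (\sum_s f (lift_perm ord0 j s)) / N.
have mc i j : `|m i - m j| <= c.
  rewrite /m -mulrBl normrM normfV (gtr0_norm N_gt0) ler_pdivrMr//.
  (* Products act from left to right, so [p * tperm i j] exchanges the values [i] and [j] and
     matches the fibres over [i] and [j]. *)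
  rewrite (sum_lift_perm_fixed _ _ j) (reindex_inj (mulIg (tperm i j)))/=.
  rewrite (eq_bigl (fun p : 'S_n.+1 => p ord0 == i)); last first.
    by move=> p; rewrite permM -{2}(tpermL i j) (inj_eq perm_inj).
  rewrite -sum_lift_perm_fixed -sumrB (le_trans (ler_norm_sum _ _ _))//.
  rewrite (le_trans (ler_sum _ (fun s _ => fc _ _ _)))//.
  by rewrite sumr_const -/#|'S_n| card_Sn -[c *+ _]mulr_natr.
(* A transposition lifted to the fibre [p ord0 = j] is again a transposition, so the induction
   hypothesis applies with the same [c]. *)
have step j : \sum_s expR (f (lift_perm ord0 j s)) <=
    N * expR (n%:R * (c ^+ 2 / 2)) * expR (m j).
  rewrite -mulrA -expRD [_ + m j]addrC; apply: IH => p x y.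
  by rewrite -(lift_permM ord0 j) lift_perm_tperm; exact: fc.
rewrite sum_lift_perm (le_trans (ler_sum _ (fun j _ => step j)))//.
rewrite -mulr_sumr.
have NE : 0 <= N * expR (n%:R * (c ^+ 2 / 2)) by rewrite mulr_ge0 ?expR_ge0// ltW.
apply: le_trans (ler_wpM2l NE (sum_expR_le _ _ _ _ mc)) _.
rewrite card_ord le_eqVlt; apply/orP; left; apply/eqP.
rewrite factS natrM -/N /m -mulr_suml -sum_lift_perm.
rewrite mulrACA -expRD [N * _]mulrC; congr (_ * expR _).
rewrite -natr1; field.
by rewrite nat1r !pnatr_eq0 -lt0n fact_gt0.
Qed.

(** * Chernoff bound *)

Lemma unif_perm_tail (R : realType) (n : nat) (f : 'S_n -> R) (c u : R) :
  (forall p i j, `|f p - f (p * tperm i j)%g| <= c) -> \sum_p f p = 0 ->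
  0 < n%:R * c ^+ 2 -> 0 <= u ->
  unif_perm_prob R (fun p => u <= f p) <=
    expR (- (u ^+ 2 / (2 * (n%:R * c ^+ 2)))).
Proof.
move=> fc f0 v_gt0 u_ge0; set v := n%:R * _ in v_gt0 *.
have v0 : v != 0 by rewrite gt_eqF.
(* This [l] minimises [l ^+ 2 * v / 2 - l * u], with minimum [- (u ^+ 2 / (2 * v))]. *)
pose l := u / v; have l_ge0 : 0 <= l by rewrite divr_ge0// ltW.
rewrite /unif_perm_prob card_Sn ler_pdivrMr ?ltr0n ?fact_gt0//.
have mgf : \sum_p expR (l * f p) <= n`!%:R * expR (l ^+ 2 * v / 2).
  have := @sum_expR_perm_le R n (fun p => l * f p) (l * c).
  rewrite -mulr_sumr f0 mulr0 mul0r add0r exprMn /v.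
  rewrite (_ : n%:R * _ = l ^+ 2 * (n%:R * c ^+ 2) / 2); last by ring.
  apply => p i j; rewrite -mulrBr normrM (ger0_norm l_ge0).
  by rewrite ler_wpM2l.
have markov : #|[pred p : 'S_n | u <= f p]|%:R * expR (l * u) <=
    \sum_p expR (l * f p).
  rewrite mulr_natl -sumr_const.
  rewrite [leRHS](bigID (fun p => u <= f p))/= -[leLHS]addr0 lerD//; last first.
    by apply: sumr_ge0 => p _; exact: expR_ge0.
  by apply: ler_sum => p up; rewrite ler_expR ler_wpM2l.
rewrite -ler_pdivlMr ?expR_gt0// in markov.
apply: le_trans markov _; rewrite ler_pdivrMr ?expR_gt0//.
apply: le_trans mgf _; rewrite [leRHS]mulrAC -expRD [leRHS]mulrC.
rewrite le_eqVlt; apply/orP; left; apply/eqP; congr (_ * expR _).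
rewrite /l; field.
by rewrite v0.
Qed.

(** * The mean of [V1] *)

Lemma sum_perm_pair (R : realType) (n : nat) (h : 'I_n -> 'I_n -> R)
    (s t s' t' : 'I_n) : s != t -> s' != t' ->
  \sum_(p : 'S_n) h (p s) (p t) = \sum_(p : 'S_n) h (p s') (p t').
Proof.
(* Double transitivity: [q] sends [s], [t] to [s'], [t'], its second factor fixing [s']; translation
   by [q^-1] preserves the sum. *)
move=> st st'; pose r := tperm s s'; pose q := (r * tperm (r t) t')%g.
have qs : q s = s'.
  rewrite permM tpermL tpermD//; last by rewrite eq_sym.
  by rewrite -(tpermL s s') (inj_eq perm_inj) eq_sym.
have qt : q t = t' by rewrite permM tpermL.
rewrite [RHS](reindex_inj (mulgI q^-1)%g)/=.
by apply: eq_bigr => p _; rewrite !permM -{1}qs -{1}qt !permK.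
Qed.

Lemma sum_V1 (R : realType) (n : nat) (a : 'I_n -> 'I_n -> 'I_n -> 'I_n -> R) :
  (forall i j k l, i = j \/ k = l -> a i j k l = 0) ->
  \sum_i \sum_j \sum_k \sum_l a i j k l = 0 ->
  \sum_(p : 'S_n) V1 a p = 0.
Proof.
move=> a_diag a_sum.
pose K := #|[pred x : 'I_n * 'I_n | x.1 != x.2]|.
(* Averaging [a s t (p s') (p t')] over [p] gives the same value for all pairs
   [s' != t'], while for fixed [p] the pair [(p s', p t')] runs over all
   off-diagonal pairs. *)
have pair s t : s != t -> K%:R * (\sum_(p : 'S_n) a s t (p s) (p t)) =
    n`!%:R * \sum_k \sum_l a s t k l.
  move=> st; rewrite mulr_natl -sumr_const.
  transitivity (\sum_(x : 'I_n * 'I_n | x.1 != x.2)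
      \sum_(p : 'S_n) a s t (p x.1) (p x.2)).
    by apply: eq_bigr => x xne; exact: sum_perm_pair.
  rewrite exchange_big/= mulr_natl -card_Sn -sumr_const; apply: eq_bigr => p _.
  rewrite [RHS]pair_big/= [RHS](bigID (fun x : 'I_n * 'I_n => x.1 == x.2))/=.
  rewrite [X in _ = X + _]big1 ?add0r; last first.
    by move=> x /eqP xe; apply: a_diag; right.
  rewrite [RHS](reindex (fun x : 'I_n * 'I_n => (p x.1, p x.2)))/=; last first.
    exists (fun x => ((p^-1)%g x.1, (p^-1)%g x.2)) => -[x y] _ /=.
      by rewrite !permK.
    by rewrite !permKV.
  by apply: eq_bigl => x; rewrite (inj_eq perm_inj).
rewrite /V1 exchange_big/=.
(* Without off-diagonal pairs [K] cannot be cancelled, but then [V1] is an empty sum. *)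
have [K0|K_gt0] := posnP K.
  apply: big1 => s _; rewrite big1// => p _; rewrite big1// => t st.
  by have := card0_eq K0 (s, t); rewrite inE/= st.
have K0 : K%:R != 0 :> R by rewrite pnatr_eq0 -lt0n.
apply: (mulfI K0); rewrite mulr0 mulr_sumr.
transitivity (n`!%:R * \sum_i \sum_j \sum_k \sum_l a i j k l); last first.
  by rewrite a_sum mulr0.
rewrite mulr_sumr; apply: eq_bigr => s _.
(* The terms [s = t] of the full sum vanish by [a_diag]. *)
rewrite exchange_big/= !mulr_sumr [RHS](bigID (fun t => s != t))/=.
rewrite [X in _ = _ + X]big1 ?addr0; last first.
  move=> t; rewrite negbK => /eqP st; rewrite big1 ?mulr0// => k _.
  by rewrite big1// => l _; apply: a_diag; left.
by apply: eq_bigr => t st; exact: pair.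
Qed.

(** * Differences of [V1] along transpositions *)

Lemma V1_tperm (R : realType) (n : nat)
    (a : 'I_n -> 'I_n -> 'I_n -> 'I_n -> R) (b : R) :
  (forall i j k l, `|a i j k l| <= b) ->
  forall p i j, `|V1 a p - V1 a (p * tperm i j)%g| <= 8 * n%:R * b.
Proof.
move=> ab p i j; set q := (p * _)%g.
pose x := (p^-1)%g i; pose y := (p^-1)%g j.
(* [d] dominates the indicator of the positions where [p] and [q] differ, and has total mass 2 even
   when [i = j]. *)
pose d s : R := (s == x)%:R + (s == y)%:R.
have d_ge0 s : 0 <= d s by rewrite addr_ge0.
have pq s : p s != q s -> 1 <= d s.
  rewrite /d; have [_|sx] := eqVneq s x; first by rewrite lerDl.
  have [_|sy] := eqVneq s y; first by rewrite lerDr.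
  rewrite permM tpermD ?eqxx//.
    by apply: contraNneq sx; rewrite /x => ->; rewrite permK.
  by apply: contraNneq sy; rewrite /y => ->; rewrite permK.
have term s t : `|a s t (p s) (p t) - a s t (q s) (q t)| <= 2 * b * (d s + d t).
  have b_ge0 : 0 <= b by apply: le_trans (ab s s s s).
  have far : `|a s t (p s) (p t) - a s t (q s) (q t)| <= 2 * b.
    rewrite (le_trans (ler_normB _ _))// (_ : 2 * b = b + b); last by ring.
    by rewrite lerD.
  have b2 : 0 <= 2 * b by rewrite mulr_ge0.
  have [es|/pq ds] := eqVneq (p s) (q s); last first.
    apply: le_trans far _; rewrite ler_peMr//.
    by rewrite (le_trans ds)// lerDl.
  have [et|/pq dt] := eqVneq (p t) (q t); last first.
    apply: le_trans far _; rewrite ler_peMr//.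
    by rewrite (le_trans dt)// lerDr.
  by rewrite es et subrr normr0 mulr_ge0// addr_ge0.
have sum_d : \sum_s d s = 2.
  rewrite /d big_split/= (bigD1 x)//= eqxx big1 => [|s /negbTE->//].
  by rewrite (bigD1 y)//= eqxx big1 => [|s /negbTE->//]; rewrite !addr0.
rewrite /V1 -sumrB (le_trans (ler_norm_sum _ _ _))//.
(* Allowing [s = t] only adds nonnegative terms; the double sum equals [2 * b * (2 * n + 2 * n)]. *)
apply: (@le_trans _ _ (\sum_s \sum_t 2 * b * (d s + d t))).
  apply: ler_sum => s _; rewrite -sumrB (le_trans (ler_norm_sum _ _ _))//.
  rewrite big_mkcond/=; apply: ler_sum => t _; case: ifP => // _.
  exact: le_trans (term s t).
rewrite le_eqVlt; apply/orP; left; apply/eqP.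
under eq_bigr do rewrite -mulr_sumr big_split/= sumr_const card_ord sum_d.
rewrite -mulr_sumr big_split/= sumr_const card_ord.
by rewrite sumrMnl sum_d; ring.
Qed.

(** * Comparison with the variance proxy, and conclusion *)

Lemma phi_ge (R : realType) (b : R) (n : nat) : (0 < n)%N ->
  64 * b ^+ 2 <= phi b n.
Proof.
move=> n_gt0; set x : R := n%:R.
have x_ge1 : 1 <= x by rewrite ler1n.
have x0 : x != 0 by rewrite gt_eqF// (lt_le_trans _ x_ge1).
(* For [x >= 1] the cubic factor is at least [4 * x + 2 - 2 * x - 1 > 0]. *)
rewrite -subr_ge0 /phi -/x (_ : _ - _ =
    b ^+ 2 * 8 * (4 * x ^+ 3 + 2 * x ^+ 2 - 2 * x - 1) / x ^+ 3); last by field.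
rewrite divr_ge0 ?exprn_ge0 ?(le_trans _ x_ge1)//.
have x2 : 1 <= x ^+ 2 by rewrite exprn_ege1.
have x3 : x <= x ^+ 3 by rewrite ler_eXnr.
by rewrite mulr_ge0 ?(mulr_ge0 (sqr_ge0 b))//; lra.
Qed.

Theorem theorem4p1 (R : realType) (n : nat)
    (a : 'I_n -> 'I_n -> 'I_n -> 'I_n -> R) (b : R)
    (a_diag : forall i j k l, i = j \/ k = l -> a i j k l = 0)
    (a_sum : \sum_i \sum_j \sum_k \sum_l a i j k l = 0)
    (a_sym : forall i j k l, a i j k l = a i j l k /\ a i j l k = a j i l k)
    (a_bound : forall i j k l, `|a i j k l| <= b) :
  forall t : R, 0 < t ->
    ((unif_perm_prob R (fun p : 'S_n => t <= W1 a p)%R)%:E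
       <= gauss_tail t (phi b n))%E /\
    ((unif_perm_prob R (fun p : 'S_n => W1 a p <= - t)%R)%:E
       <= gauss_tail t (phi b n))%E.
Proof.
move=> t t_gt0.
(* In both degenerate cases [phi b n = 0] (for [n = 0], because division by zero gives 0), so the
   bound is 0; it holds because [W1] vanishes and both events are empty. *)
have [deg|/norP[n0 b0]] := boolP ((n == 0)%N || (b == 0)).
  have W0 p : W1 a p = 0.
    rewrite /W1 /V1 big1 ?mulr0// => s _; rewrite big1// => r _.
    move: deg => /orP[/eqP n0|/eqP b0]; first by have := ltn_ord s; rewrite {2}n0.
    by apply/eqP; rewrite -normr_le0 -[X in _ <= X]b0.
  have P0 (E : pred 'S_n) : (forall p, E p = false) ->
      ((unif_perm_prob R E)%:E <= gauss_tail t (phi b n))%E.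
    by move=> E0; rewrite /unif_perm_prob eq_card0// mul0r expeR_ge0.
  split; apply: P0 => p; rewrite W0; first by rewrite leNgt t_gt0.
  by rewrite oppr_ge0 leNgt t_gt0.
have n_gt0 : (0 < n)%N by rewrite lt0n.
have x_gt0 : 0 < n%:R :> R by rewrite ltr0n.
have b2_gt0 : 0 < b ^+ 2 by rewrite exprn_even_gt0.
have v_gt0 : 0 < phi b n.
  by apply: lt_le_trans (phi_ge _ b _ n_gt0); rewrite mulr_gt0.
have -> : gauss_tail t (phi b n) = (expR (- (t ^+ 2 / (2 * phi b n))))%:E.
  by rewrite /gauss_tail inver gt_eqF// mulr_gt0.
rewrite !lee_fin.
(* [c] is the bound of [V1_tperm] rescaled by [w], whence
   [n c^2 = n * n^-3 * 64 n^2 b^2 = 64 b^2]. *)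
pose w : R := n%:R `^ (- (3 / 2)); pose c := w * (8 * n%:R * b).
have w_ge0 : 0 <= w by rewrite powR_ge0.
have w2 : w ^+ 2 = n%:R ^- 3.
  rewrite /w -powR_mulrn ?powR_ge0// -powRrM -powR_invn ?ltW//.
  by congr (_ `^ _); field.
have nc2 : n%:R * c ^+ 2 = 64 * b ^+ 2.
  by rewrite /c exprMn w2; field; rewrite gt_eqF.
have Wc p i j : `|W1 a p - W1 a (p * tperm i j)%g| <= c.
  by rewrite /W1 -mulrBr normrM (ger0_norm w_ge0) ler_wpM2l// V1_tperm.
have W_sum : \sum_(p : 'S_n) W1 a p = 0.
  by rewrite -mulr_sumr sum_V1// mulr0.
have gauss_le : expR (- (t ^+ 2 / (2 * (n%:R * c ^+ 2)))) <=
    expR (- (t ^+ 2 / (2 * phi b n))).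
  rewrite ler_expR lerN2 ler_wpM2l ?sqr_ge0// nc2.
  have v2 : 0 < 2 * phi b n by rewrite pmulr_rgt0.
  have v1 : 0 < 2 * (64 * b ^+ 2) by rewrite mulr_gt0// mulr_gt0.
  rewrite lef_pV2 ?posrE ?v1 ?v2//.
  by rewrite ler_pM2l// phi_ge.
have nc_gt0 : 0 < n%:R * c ^+ 2 by rewrite nc2 mulr_gt0.
split; apply: (le_trans _ gauss_le).
  by apply: unif_perm_tail => //; exact: ltW.
(* The lower tail is the upper tail of [- W1], which has mean zero and the same bound on
   differences. *)
rewrite [unif_perm_prob _ _](_ : _ = unif_perm_prob R (fun p => t <= - W1 a p)).
  apply: unif_perm_tail => //; last exact: ltW.
    by move=> p i j; rewrite opprK addrC distrC.
  by rewrite sumrN W_sum oppr0.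
by congr (#|_|%:R / _); apply/funext => p; rewrite lerNr.
Qed.
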